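(* Let $m\ge 2$ and $n$ be positive integers, let $\mathfrak{p}$ be a symmetric winning rule for $m$ players, and consider a game of $\mathfrak{p}$-war with $m$ players and a deck of $n$ cards. Let $\mathbf{x}=(x_1,\dots,x_m)$ be the distribution of the cards at the start of the game, i.e. $x_i$ is the number of cards in player $i$'s hand at time $0$ (nonnegative integers with $\sum_i x_i=n$). Let $A_{i,t}=|A_i(t)|$ be the number of cards in player $i$'s hand at time $t$. Then $(A_{i,t})_{i\in[m]}$, $t=0,1,2,\dots$, is a simple sticky random walk starting at $\mathbf{x}$.
   Context: Write $[m]=\{1,\dots,m\}$. The deck $D$ has $n$ distinct cards. $A_i(t)$ is the set of cards in player $i$'s hand at time $t$. In each round player $i$ plays a card $a_i$ from $A_i(t)$; if $A_i(t)=\varnothing$ the player plays no card, denoted $a_i=\varnothing$. Put $S_i=A_i(t)\setminus\{a_i\}$. The tuple $T=(a_1,\dots,a_m,S_1,\dots,S_m)$ is called a game tuple. A winning rule $\mathfrak{p}$ maps a game tuple $T$ to an $m$-dimensional vector whose $i$th entry $\mathfrak{p}_i(T)$ is the probability that player $i$ wins (so the entries are nonnegative and sum to $1$), such that: if $a_i=\varnothing$ then $\mathfrak{p}_i(T)=0$; and for all permutations $\sigma$ of $[m]$, $\mathfrak{p}_i(a_1,\dots,a_m,S_1,\dots,S_m)=\mathfrak{p}_{\sigma^{-1}(i)}(a_{\sigma(1)},\dots,a_{\sigma(m)},S_{\sigma(1)},\dots,S_{\sigma(m)})$. The rule is symmetric if for all $i$ and all permutations $\sigma$ of $[m]$, $\mathfrak{p}_i(a_1,\dots,a_m,S_1,\dots,S_m)=\mathfrak{p}_{\sigma^{-1}(i)}(a_{\sigma(1)},\dots,a_{\sigma(m)},S_1,\dots,S_m)$.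 $\mathfrak{p}$-war is the Markov chain on $\{(A_i)_{i\in[m]}: \bigsqcup_i A_i=D\}$ defined as follows. The initial hands are obtained by choosing a vector $\mathbf{x}$ of $m$ nonnegative integers with sum $n$, randomly (uniformly) shuffling the deck and partitioning the cards among the players so that $|A_i(0)|=x_i$. At each turn, each player with a nonempty hand independently draws a uniformly random card $a_i$ from their hand; then, with probability $\mathfrak{p}_j(T)$ where $T$ is the game tuple, player $j$ wins, and $A_j(t+1)=A_j(t)\cup\{a_1,\dots,a_m\}$ (only actual cards being added) while $A_i(t+1)=A_i(t)\setminus\{a_i\}$ for $i\neq j$. A simple sticky random walk is the random walk on $\Delta_n^{m-1}=\{(x_1,\dots,x_m)\in\mathbb{N}^m:\sum_i x_i=n\}$ ($\mathbb{N}$ includes $0$) whose state at time $t$ is $(A_{i,t})_{i\in[m]}$ and whose transitions are: let $C_t$ be the set of $i$ with $A_{i,t}>0$; choose $j\in C_t$ uniformly; set $A_{j,t+1}=A_{j,t}+|C_t|-1$, $A_{i,t+1}=A_{i,t}-1$ for $i\in C_t\setminus\{j\}$, and $A_{i,t+1}=0$ for $i\notin C_t$. *)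

(* Defs.v *)
From mathcomp Require Import all_boot all_order all_algebra all_fingroup.
From mathcomp Require Import all_classical all_reals all_analysis.

Set Implicit Arguments.
Unset Strict Implicit.
Unset Printing Implicit Defensive.

Import Order.TTheory GRing.Theory Num.Theory.
Local Open Scope ring_scope.

Section MarkovChain.
Context (R : realType) (d : measure_display) (T : measurableType d).
Variable P : probability T R.

Definition cond_prob (A B : set T) : R := fine (P (A `&` B)%classic) / fine (P B).

(* Discrete-time Markov chain with state space [E], initial law [mu] and
   transition probabilities [K]. Since [S] is countable, measurability of [X t]
   amounts to measurability of the events {X t = s}. *)
Definition markov_chain (S : countType) (E : set S) (mu : S -> R)
    (K : S -> S -> R) (X : nat -> T -> S) : Prop :=
  [/\ forall t w, E (X t w),
      forall t s, measurable (X t @^-1` [set s])%classic,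
      forall s, P (X 0%N @^-1` [set s])%classic = (mu s)%:E &
      forall (t : nat) (s : nat -> S),
        let past := [set w | forall k, (k <= t)%N -> X k w = s k]%classic in
        P past <> 0%E ->
        cond_prob (X t.+1 @^-1` [set s t.+1])%classic past = K (s t) (s t.+1)].

End MarkovChain.

Section War.
Variables (R : realType) (D : finType) (m : nat).

Local Open Scope set_scope.

Definition hands := {ffun 'I_m -> {set D}}.

(* [None] stands for a player who plays no card. *)
Definition plays := {ffun 'I_m -> option D}.

Definition is_deal (A : hands) : Prop :=
  \bigcup_(i < m) A i = [set: D] /\
  (forall i j, i != j -> [disjoint A i & A j]).

Definition playable (B : {set D}) (o : option D) : bool :=
  if o is Some c then c \in B else B == finset.set0.

Definition played (o : option D) : {set D} :=
  if o is Some c then finset.set1 c else finset.set0.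

Definition remaining (A : hands) (a : plays) : hands :=
  [ffun i => A i :\: played (a i)].

Definition game_tuple (a : plays) (S : hands) : Prop :=
  exists A : hands,
    [/\ is_deal A, forall i, playable (A i) (a i) & S = remaining A a].

Definition permute (X : Type) (s : 'S_m) (f : {ffun 'I_m -> X}) :
  {ffun 'I_m -> X} := [ffun i => f (s i)].

(* A rule is a total function; its values are only constrained, and only used,
   on game tuples. *)
Definition rule := plays -> hands -> 'I_m -> R.

Definition winning_rule (p : rule) : Prop :=
  forall a S, game_tuple a S ->
    [/\ forall i, 0 <= p a S i,
        \sum_(i < m) p a S i = 1,
        forall i, a i = None -> p a S i = 0 &
        forall (s : 'S_m) i,
          p a S i = p (permute s a) (permute s S) ((s^-1)%g i)].

(* Permuting only the played cards yields a game tuple unless some player with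
   [S i] nonempty would then play no card. *)
Definition symmetric_rule (p : rule) : Prop :=
  forall a S (s : 'S_m) i, game_tuple a S -> game_tuple (permute s a) S ->
    p a S i = p (permute s a) S ((s^-1)%g i).

(* [pi c] determines the position of card [c] in the shuffled deck; player [i]
   receives the [x i] consecutive cards following those of players [k < i]. *)
Definition deal (x : {ffun 'I_m -> nat}) (pi : {perm D}) : hands :=
  [ffun i : 'I_m => finset (fun c : D =>
    (\sum_(k < m | (k < i)%N) x k <= enum_rank (pi c)
       < \sum_(k < m | (k <= i)%N) x k)%N)].

Definition shuffle_law (x : {ffun 'I_m -> nat}) (A : hands) : R :=
  \sum_(pi : {perm D}) (#|{perm D}|%:R)^-1 * (deal x pi == A)%:R.

Definition draw_prob (B : {set D}) (o : option D) : R :=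
  if o is Some c then (c \in B)%:R / #|B|%:R else (B == finset.set0)%:R.

Definition war_step (A : hands) (a : plays) (j : 'I_m) : hands :=
  [ffun i => if i == j then A i :|: \bigcup_(k < m) played (a k)
             else A i :\: played (a i)].

Definition war_kernel (p : rule) (A A' : hands) : R :=
  \sum_(a : plays) (\prod_(i < m) draw_prob (A i) (a i)) *
    \sum_(j < m) p a (remaining A a) j * (war_step A a j == A')%:R.

Definition war (d : measure_display) (T : measurableType d)
    (P : probability T R) (p : rule) (x : {ffun 'I_m -> nat})
    (A : nat -> T -> hands) : Prop :=
  markov_chain P is_deal (shuffle_law x) (war_kernel p) A.

End War.

Section StickyWalk.
Variables (R : realType) (m : nat).

Definition discrete_simplex (n : nat) (x : {ffun 'I_m -> nat}) : Prop :=
  (\sum_(i < m) x i = n)%N.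

Definition active (x : {ffun 'I_m -> nat}) : {set 'I_m} :=
  finset (fun i => (0 < x i)%N).

Definition sticky_step (x : {ffun 'I_m -> nat}) (j : 'I_m) :
  {ffun 'I_m -> nat} :=
  [ffun i => if i == j then (x i + #|active x| - 1)%N
             else if i \in active x then (x i - 1)%N else 0%N].

Definition sticky_kernel (x y : {ffun 'I_m -> nat}) : R :=
  \sum_(j in active x) (#|active x|%:R)^-1 * (sticky_step x j == y)%:R.

Definition simple_sticky_random_walk (d : measure_display)
    (T : measurableType d) (P : probability T R) (n : nat)
    (x : {ffun 'I_m -> nat}) (X : nat -> T -> {ffun 'I_m -> nat}) : Prop :=
  markov_chain P (discrete_simplex n) (fun y => (y == x)%:R) sticky_kernel X.

End StickyWalk.

(* Main.v *)
Require Import Defs.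
From mathcomp Require Import all_boot all_order all_algebra all_fingroup.
From mathcomp Require Import all_classical all_reals all_analysis.

Set Implicit Arguments.
Unset Strict Implicit.
Unset Printing Implicit Defensive.

Import Order.TTheory GRing.Theory Num.Theory.
Local Open Scope ring_scope.

(** Given only the history of the hand sizes, the hands are always uniformly
distributed over the deals with the current sizes. This holds at time 0 because
the deck is shuffled. To see that a turn preserves it, fix the hands [A'] after
the turn and the winner [j]. The turns leading from sizes [x] to this outcome
are stable under exchanging the cards played by [j] and by another active
player [k]: the cards kept are unchanged, and all the played cards end up in
hand [j] anyway. By symmetry of the rule the exchange turns the probability that
[k] wins into the probability that [j] wins, so these probabilities have the
same total over the turns considered, namely a share [1 / |C|] of their weight,
where [C] is the set of active players ([win_mass_exchange], [win_massE]).
So the probability of reaching [A'] is what it would be if the winner were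
drawn uniformly from [C], independently of the cards. That simplified dynamics
commutes with renaming the cards, and renamings act transitively on the deals
with given sizes; hence it gives the same mass to all deals of the same sizes,
and that mass is found by summing over them ([award_massE]).

In terms of kernels, this says that [L K = Q L], where [K] is the kernel of the
game, [Q] that of the sticky walk, and [L y] the uniform law on the deals with
sizes [y] ([war_sticky_intertwining]). By a criterion going back to Rogers and
Pitman, such an intertwining makes the image of the chain under the size map a
Markov chain with kernel [Q] ([markov_chain_intertwining]).

Deals are handled as functions [o] from cards to players giving the owner of
each card: any such function is a deal, and card exchanges, awards and renamings
are simple operations on it. *)

(** * Deals as owner functions *)

Section Owners.
Variables (D : finType) (m : nat).
Implicit Types (o : {ffun D -> 'I_m}) (g : {perm D}) (a : plays D m).

Definition hands_of o : hands D m := [ffun i => finset (fun c => o c == i)].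

Definition sizes (A : hands D m) : {ffun 'I_m -> nat} := [ffun i => #|A i|].

Lemma in_hands_of o i c : (c \in hands_of o i) = (o c == i).
Proof. by rewrite ffunE inE. Qed.

Lemma sizesE A i : sizes A i = #|A i|.
Proof. by rewrite ffunE. Qed.

Lemma hands_of_inj : injective hands_of.
Proof.
move=> o o' /ffunP eq_oo'; apply/ffunP => c; apply/eqP.
by rewrite -in_hands_of eq_oo' in_hands_of.
Qed.

Lemma is_deal_hands_of o : is_deal (hands_of o).
Proof.
split=> [|i j neq_ij].
  apply/finset.setP => c; rewrite finset.in_setT; apply/finset.bigcupP.
  exists (o c) => //.
  by rewrite in_hands_of.
rewrite disjoint_subset; apply/fintype.subsetP => c.
by rewrite !inE !in_hands_of => /eqP ->.
Qed.

Lemma is_dealP (A : hands D m) : is_deal A -> exists o, A = hands_of o.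
Proof.
move=> [coverA disjA].
have /fin_all_exists [f fP] (c : D) : exists i, c \in A i.
  have: c \in [set: D]%SET by rewrite finset.in_setT.
  by rewrite -coverA => /finset.bigcupP [i _ Ai]; exists i.
exists (finfun f); apply/ffunP => i; apply/finset.setP => c.
rewrite in_hands_of ffunE; apply/idP/eqP => [Aic|<-//].
apply/eqP/negPn/negP => /disjA /disjoint_setI0 /finset.setP /(_ c).
by rewrite inE fP Aic inE.
Qed.

Lemma sum_sizes_hands_of o : (\sum_i sizes (hands_of o) i = #|D|)%N.
Proof.
rewrite -sum1_card (partition_big o xpredT) //=; apply: eq_bigr => i _.
by rewrite sizesE -sum1_card; apply: eq_bigl => c; rewrite in_hands_of.
Qed.

Definition relabel g o : {ffun D -> 'I_m} := [ffun c => o (g c)].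

Lemma relabelK g : cancel (relabel g) (relabel g^-1%g).
Proof. by move=> o; apply/ffunP => c; rewrite !ffunE permKV. Qed.

Lemma relabelKV g : cancel (relabel g^-1%g) (relabel g).
Proof. by move=> o; apply/ffunP => c; rewrite !ffunE permK. Qed.

Lemma relabel_bij g : bijective (relabel g).
Proof. exact: Bijective (relabelK g) (relabelKV g). Qed.

Lemma card_hands_of_relabel g o i :
  #|hands_of (relabel g o) i| = #|hands_of o i|.
Proof.
rewrite -[RHS](finset.card_preimset _ (@perm_inj _ g)).
by apply: eq_card => c; rewrite inE !in_hands_of ffunE.
Qed.

Lemma sizes_relabel g o : sizes (hands_of (relabel g o)) = sizes (hands_of o).
Proof. by apply/ffunP => i; rewrite !sizesE card_hands_of_relabel. Qed.

(** Listing the owners of all cards gives two words with the same letter counts,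
so one is a rearrangement of the other. *)
Lemma relabel_transitive o o' : sizes (hands_of o) = sizes (hands_of o') ->
  exists g, o' = relabel g o.
Proof.
move=> eq_sz.
pose t (u : {ffun D -> 'I_m}) : #|D|.-tuple 'I_m :=
  [tuple u (enum_val i) | i < #|D|].
have cnt (u : {ffun D -> 'I_m}) i : count_mem i (t u) = sizes (hands_of u) i.
  rewrite /t /= -sum1_count big_map big_enum_cond sizesE -[RHS]sum1_card.
  rewrite [RHS](reindex _ (onW_bij _ (enum_val_bij D))) /=.
  by apply: eq_bigl => k; rewrite in_hands_of.
have /tuple_permP [s /val_inj eq_t] : perm_eq (t o') (t o).
  by apply/allP => i _ /=; rewrite !cnt eq_sz.
have inj_g : injective (fun c => enum_val (s (enum_rank c))).
  by move=> c c' /enum_val_inj /perm_inj /enum_rank_inj.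
exists (perm inj_g); apply/ffunP => c; rewrite ffunE permE.
have := congr1 (fun u : #|D|.-tuple 'I_m => tnth u (enum_rank c)) eq_t.
by rewrite !tnth_mktuple enum_rankK.
Qed.

End Owners.

(** * One turn of the game, for given cards and a given winner *)

Section Turn.
Variables (D : finType) (m : nat).
Implicit Types (o : {ffun D -> 'I_m}) (a : plays D m) (s : 'S_m) (j k : 'I_m).

Definition legal o a := [forall i, playable (hands_of o i) (a i)].

Definition drawn o a c := a (o c) == Some c.

(** For legal plays [a], this is the deal from which the permuted plays leave the
same cards in every hand as [a] does from [o]. *)
Definition exchange s o a : {ffun D -> 'I_m} :=
  [ffun c => if drawn o a c then (s^-1)%g (o c) else o c].

Definition award o a j : {ffun D -> 'I_m} :=
  [ffun c => if drawn o a c then j else o c].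

Notation hand_active o := (active (sizes (hands_of o))).

Lemma legal_some o a i c :
  legal o a -> (a i == Some c) = (o c == i) && drawn o a c.
Proof.
move=> /forallP /(_ i); rewrite /drawn; case: (eqVneq (o c) i) => [->|neq] //=.
by move=> H; apply/negP => /eqP E; move: H; rewrite E /= in_hands_of (negbTE neq).
Qed.

Lemma legal_none o a i : legal o a -> (a i == None) = (i \notin hand_active o).
Proof.
move=> /forallP /(_ i); rewrite inE sizesE -leqNgt leqn0 cards_eq0.
case: (a i) => [c|] /= H; last by rewrite H eqxx.
by apply/esym/negP => /eqP E; move: H; rewrite E inE.
Qed.

Lemma card_drawn o a i : legal o a ->
  #|finset (fun c => (o c == i) && drawn o a c)| = (i \in hand_active o).
Proof.
move=> la; case E: (a i) => [c|].
  have -> : i \in hand_active o by rewrite -[_ \in _]negbK -(legal_none _ la) E.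
  apply/eqP/cards1P; exists c; apply/finset.setP => c'.
  by rewrite !inE -(legal_some _ _ la) E; apply/eqP/eqP => [[]|->].
have /negbTE -> : i \notin hand_active o by rewrite -(legal_none _ la) E.
apply/eqP; rewrite cards_eq0; apply/eqP/finset.setP => c'.
by rewrite !inE -(legal_some _ _ la) E.
Qed.

Lemma remaining_hands_of o a i c :
  legal o a -> (c \in remaining (hands_of o) a i) = (o c == i) && ~~ drawn o a c.
Proof.
move=> la; rewrite ffunE inE in_hands_of andbC.
have -> : (c \in played (a i)) = (a i == Some c).
  by case: (a i) => [c'|] /=; rewrite inE // eq_sym.
by rewrite (legal_some _ _ la); case: (o c == i).
Qed.

Lemma war_step_hands_of o a j :
  legal o a -> war_step (hands_of o) a j = hands_of (award o a j).
Proof.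
move=> la; apply/ffunP => i; apply/finset.setP => c.
rewrite in_hands_of ffunE [in RHS]ffunE; case: (eqVneq i j) => [->|neq_ij].
  rewrite finset.in_setU in_hands_of.
  have -> : (c \in \bigcup_(k < m) played (a k))%SET = drawn o a c.
    apply/finset.bigcupP/idP => [[k _]|]; last first.
      by rewrite /drawn => /eqP E; exists (o c) => //; rewrite E inE.
    case E: (a k) => [c'|] /=; rewrite inE // => /eqP eq_c.
    by move: (legal_some k c la); rewrite E eq_c eqxx => /esym /andP [].
  by case: ifP => _; rewrite ?eqxx ?orbT ?orbF.
have := remaining_hands_of i c la; rewrite ffunE => ->.
by case: ifP; rewrite ?andbT // andbF eq_sym (negbTE neq_ij).
Qed.

Lemma sizes_award o a j : legal o a -> j \in hand_active o ->
  sizes (hands_of (award o a j)) = sticky_step (sizes (hands_of o)) j.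
Proof.
move=> la jC; apply/ffunP => i; rewrite sizesE [RHS]ffunE sizesE.
have split_hand k : #|hands_of o k| =
    ((k \in hand_active o) +
     #|finset (fun c => (o c == k) && ~~ drawn o a c)|)%N.
  rewrite -(card_drawn k la) -(cardsID (finset (fun c => drawn o a c))).
  by congr addn; apply: eq_card => c; rewrite !inE in_hands_of // andbC.
have kept : #|finset (fun c => (o c == i) && ~~ drawn o a c)| =
    (#|hands_of o i| - (i \in hand_active o))%N.
  by rewrite split_hand addKn.
case: (eqVneq i j) => [eq_ij|neq_ij].
  have -> : #|hands_of (award o a j) i| =
      (#|finset (fun c => drawn o a c)| +
       #|finset (fun c => (o c == i) && ~~ drawn o a c)|)%N.
    rewrite -(cardsID (finset (fun c => drawn o a c))) eq_ij.
    congr addn; apply: eq_card => c; rewrite !inE in_hands_of ffunE.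
      by case: ifP; rewrite ?eqxx ?andbF.
    by case: ifP; rewrite /= ?andbF ?andbT.
  have -> : #|finset (fun c => drawn o a c)| = #|hand_active o|.
    rewrite -!sum1_card (partition_big o xpredT) //= [RHS]big_mkcond /=.
    apply: eq_bigr => k _; rewrite -[RHS]/(nat_of_bool (k \in _)) -(card_drawn k la).
    by rewrite -sum1_card; apply: eq_bigl => c; rewrite !inE andbC.
  have hand_j : (0 < #|hands_of o j|)%N by move: jC; rewrite inE sizesE.
  by rewrite kept eq_ij jC addnBA // addnC.
have -> : #|hands_of (award o a j) i| =
    #|finset (fun c => (o c == i) && ~~ drawn o a c)|.
  apply: eq_card => c; rewrite !inE in_hands_of ffunE.
  by case: ifP; rewrite ?andbT ?andbF // eq_sym (negbTE neq_ij).
rewrite kept; case: ifP => [_ //|/negbT]; rewrite inE sizesE lt0n negbK => /eqP ->.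
by rewrite sub0n.
Qed.

(** The permutation must preserve the set of active players: a player without
cards has no card to trade. *)
Section Exchange.
Variables (o : {ffun D -> 'I_m}) (a : plays D m) (s : 'S_m).
Hypotheses (la : legal o a)
  (sC : forall i, (s i \in hand_active o) = (i \in hand_active o)).

Lemma drawn_exchange c : drawn (exchange s o a) (permute s a) c = drawn o a c.
Proof.
rewrite {1}/drawn !ffunE; case: (boolP (drawn o a c)) => dc.
  by rewrite permKV.
by rewrite (legal_some _ _ la) (negbTE dc) andbF.
Qed.

(** The undrawn cards stay in place, and each hand has as many drawn cards as
before: one if its player is active, none otherwise. *)
Lemma sizes_exchange : sizes (hands_of (exchange s o a)) = sizes (hands_of o).
Proof.
apply/ffunP => i; rewrite !sizesE.
rewrite -(cardsID (finset (fun c => drawn o a c))).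
rewrite -[RHS](cardsID (finset (fun c => drawn o a c))); congr addn; last first.
  by apply: eq_card => c; rewrite !inE !in_hands_of ffunE; case: ifP.
transitivity (nat_of_bool (i \in hand_active o)); last first.
  by rewrite -(card_drawn i la); apply: eq_card => c; rewrite !inE in_hands_of andbC.
rewrite -sC -(card_drawn (s i) la); apply: eq_card => c.
rewrite !inE in_hands_of ffunE andbC; case: ifP => //= _; rewrite ?andbF // andbT.
by apply/eqP/eqP => [<-|->]; rewrite ?permKV ?permK.
Qed.

Lemma legal_exchange : legal (exchange s o a) (permute s a).
Proof.
apply/forallP => i; rewrite [permute s a i]ffunE; case E: (a (s i)) => [c|] /=.
  have /andP [/eqP oc dc] : (o c == s i) && drawn o a c.
    by rewrite -(legal_some _ _ la) E.
  by rewrite in_hands_of ffunE dc oc permK.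
have : i \notin hand_active o by rewrite -sC -(legal_none _ la) E.
by rewrite -sizes_exchange inE sizesE lt0n negbK cards_eq0.
Qed.

Lemma remaining_exchange :
  remaining (hands_of (exchange s o a)) (permute s a) =
  remaining (hands_of o) a.
Proof.
apply/ffunP => i; apply/finset.setP => c.
rewrite !remaining_hands_of ?legal_exchange // drawn_exchange ffunE.
by case: ifP => // _; rewrite !andbF.
Qed.

Lemma award_exchange j :
  award (exchange s o a) (permute s a) j = award o a j.
Proof. by apply/ffunP => c; rewrite !ffunE drawn_exchange; case: (drawn o a c). Qed.

End Exchange.
End Turn.

(** * Averaging over the uniform deals with given sizes *)

Section WarTurn.
Variables (R : realType) (D : finType) (m : nat).
Implicit Types (o : {ffun D -> 'I_m}) (a : plays D m) (x y : {ffun 'I_m -> nat}).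

Definition draw_weight o a : R := \prod_(i < m) draw_prob R (hands_of o i) (a i).

Lemma draw_probE (B : {set D}) b : draw_prob R B b =
  (playable B b)%:R * (if (0 < #|B|)%N then #|B|%:R^-1 else 1).
Proof.
rewrite lt0n cards_eq0; case: b => [c|] /=; case: eqVneq => [->|//];
  by rewrite ?inE ?mul0r ?mulr1.
Qed.

Lemma sum_draw_prob (B : {set D}) : \sum_b draw_prob R B b = 1.
Proof.
rewrite (bigD1 None) //= (reindex_omap Some id) /=; last by case.
under eq_bigl do rewrite eqxx.
have [->|B0] := eqVneq B finset.set0.
  by rewrite big1 ?addr0 // => c _; rewrite inE mul0r.
rewrite add0r -mulr_suml -natr_sum -big_mkcond sum1_card divff //.
by rewrite pnatr_eq0 cards_eq0.
Qed.

Lemma sum_draw_weight o : \sum_a draw_weight o a = 1.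
Proof.
rewrite -(bigA_distr_bigA (fun i => draw_prob R (hands_of o i))) big1 // => i _.
exact: sum_draw_prob.
Qed.

Definition turn_weight x : R := \prod_(i < m) (if (0 < x i)%N then (x i)%:R^-1 else 1).

(** Legal plays from deals with the same sizes are equally likely; this is what
makes exchanges and renamings weight-preserving. *)
Lemma draw_weightE o a :
  draw_weight o a = (legal o a)%:R * turn_weight (sizes (hands_of o)).
Proof.
rewrite /draw_weight /turn_weight.
under eq_bigr do rewrite draw_probE.
rewrite big_split /=; congr (_ * _); last by apply: eq_bigr => i _; rewrite sizesE.
case: (boolP (legal o a)) => [/forallP la|]; first by rewrite big1 // => i _; rewrite la.
by rewrite negb_forall => /existsP [i ni]; rewrite (bigD1 i) //= (negbTE ni) mul0r.
Qed.

(** Total weight of the turns, from a deal with sizes [x], whose outcome is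
[o'] once all drawn cards are given to player [j] by fiat. *)
Definition award_mass x j o' : R :=
  \sum_(o | sizes (hands_of o) == x) \sum_a draw_weight o a * (award o a j == o')%:R.

Definition fibre_card x : R := #|finset (fun o => sizes (hands_of o) == x)|%:R.

Lemma sum_fibre_const x (r : R) :
  \sum_(o : {ffun D -> 'I_m} | sizes (hands_of o) == x) r = fibre_card x * r.
Proof.
rewrite sumr_const mulr_natl; congr (_ *+ _).
by apply: eq_card => o; rewrite inE.
Qed.

(** A function that is invariant under renaming the cards is constant on each
fibre of the size map, by transitivity. *)
Lemma sum_fibre (f : {ffun D -> 'I_m} -> R) o :
  (forall g o', f (relabel g o') = f o') ->
  \sum_(o' | sizes (hands_of o') == sizes (hands_of o)) f o' =
  fibre_card (sizes (hands_of o)) * f o.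
Proof.
move=> fg; rewrite (eq_bigr (fun=> f o)) => [|o' /eqP eq_sz]; last first.
  by have [g ->] := relabel_transitive (esym eq_sz); rewrite fg.
exact: sum_fibre_const.
Qed.

Lemma award_mass_relabel x j g o' :
  award_mass x j (relabel g o') = award_mass x j o'.
Proof.
pose ra a : plays D m := [ffun i => omap (g^-1)%g (a i)].
have ra_bij : bijective ra.
  exists (fun a => [ffun i => omap g (a i)]) => a; apply/ffunP => i; rewrite !ffunE.
    by case: (a i) => //= c; rewrite permKV.
  by case: (a i) => //= c; rewrite permK.
have drawn_ra o a c : drawn (relabel g o) (ra a) c = drawn o a (g c).
  rewrite /drawn !ffunE; case: (a _) => //= c'.
  by rewrite !(inj_eq Some_inj) (can2_eq (permKV g) (permK g)).
rewrite /award_mass (reindex _ (onW_bij _ (relabel_bij m g))) /=.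
apply: eq_big => [u|o _]; first by rewrite sizes_relabel.
rewrite (reindex _ (onW_bij _ ra_bij)) /=; apply: eq_bigr => a _; congr (_ * _).
  rewrite !draw_weightE sizes_relabel; congr ((nat_of_bool _)%:R * _).
  apply: eq_forallb => i; rewrite [ra a i]ffunE; case: (a i) => [c|] /=.
    by rewrite !in_hands_of ffunE permKV.
  by rewrite -!cards_eq0 card_hands_of_relabel.
have -> : award (relabel g o) (ra a) j = relabel g (award o a j).
  by apply/ffunP => c; rewrite !ffunE drawn_ra.
by rewrite (inj_eq (bij_inj (relabel_bij m g))).
Qed.

(** The sizes after the award do not depend on the cards drawn, so the draws
sum out. *)
Lemma sum_award_mass x y j : j \in active x ->
  \sum_(o' | sizes (hands_of o') == y) award_mass x j o' =
  fibre_card x * (sticky_step x j == y)%:R.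
Proof.
move=> jx; rewrite exchange_big /=.
transitivity (\sum_(o : {ffun D -> 'I_m} | sizes (hands_of o) == x)
    (sticky_step x j == y)%:R : R).
  apply: eq_bigr => o /eqP eq_x; rewrite exchange_big /=.
  rewrite -[RHS]mul1r -[X in X * _](sum_draw_weight o) mulr_suml; apply: eq_bigr => a _.
  rewrite draw_weightE; case: (boolP (legal o a)) => la; last first.
    by rewrite !mul0r big1 // => *; rewrite mul0r.
  rewrite -mulr_sumr; congr (_ * _).
  rewrite -eq_x -(sizes_award la) ?eq_x // (big_mkcond (fun o' => _ == y)) /=.
  rewrite (bigD1 (award o a j)) //= eqxx big1 ?addr0 => [|o' neq].
    by case: ifP.
  by rewrite [_ == o']eq_sym (negbTE neq) if_same.
exact: sum_fibre_const.
Qed.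

Lemma award_massE x j o' : j \in active x ->
  fibre_card (sizes (hands_of o')) * award_mass x j o' =
  fibre_card x * (sticky_step x j == sizes (hands_of o'))%:R.
Proof.
by move=> jx; rewrite -sum_award_mass // sum_fibre // => g o; exact: award_mass_relabel.
Qed.

Section Rule.
Variables (p : rule R D m).
Hypotheses (hp : winning_rule p) (hsym : symmetric_rule p).

Lemma game_tuple_legal o a : legal o a -> game_tuple a (remaining (hands_of o) a).
Proof.
by move=> /forallP la; exists (hands_of o); split=> //; exact: is_deal_hands_of.
Qed.

(** Same turns as in [award_mass], now weighted by the chance that [k] wins; the
recipient [j] of the cards and the possible winner [k] are kept apart so that
[k] can vary while the outcome is fixed. *)
Definition win_mass x j k o' : R :=
  \sum_(o | sizes (hands_of o) == x) \sum_a
    draw_weight o a * (award o a j == o')%:R * p a (remaining (hands_of o) a) k.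

(** Exchanging the cards drawn by [j] and [k] is a weight-preserving involution
of the turns with outcome [o'], and symmetry of the rule makes it swap the roles
of [j] and [k] as winners. *)
Lemma win_mass_exchange x j k o' : j \in active x -> k \in active x ->
  win_mass x j k o' = win_mass x j j o'.
Proof.
move=> jx kx; pose s := tperm j k.
have sV : s^-1%g = s by rewrite tpermV.
have sx i : (s i \in active x) = (i \in active x).
  by rewrite /s; case: tpermP => // ->; rewrite jx kx.
have massE l : win_mass x j l o' =
    \sum_(u : {ffun D -> 'I_m} * plays D m | (sizes (hands_of u.1) == x) && legal u.1 u.2)
      turn_weight x * (award u.1 u.2 j == o')%:R * p u.2 (remaining (hands_of u.1) u.2) l.
  rewrite /win_mass pair_big_dep /= [LHS]big_mkcond [RHS]big_mkcond /=.
  apply: eq_bigr => [[u a]] _ /=; case: eqP => //= <-.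
  rewrite draw_weightE; case: (legal u a); first by rewrite mul1r.
  by rewrite !mul0r.
rewrite !massE.
pose h (u : {ffun D -> 'I_m} * plays D m) := (exchange s u.1 u.2, permute s u.2).
have hC o : sizes (hands_of o) = x -> forall i,
    (s i \in active (sizes (hands_of o))) = (i \in active (sizes (hands_of o))).
  by move=> ->.
have hP u : (sizes (hands_of u.1) == x) && legal u.1 u.2 ->
    (sizes (hands_of (h u).1) == x) && legal (h u).1 (h u).2.
  case: u => u a /= /andP [/eqP eq_x la].
  by rewrite sizes_exchange ?eq_x ?eqxx //= legal_exchange // eq_x.
have hK u : (sizes (hands_of u.1) == x) && legal u.1 u.2 -> h (h u) = u.
  case: u => u a /= /andP [/eqP eq_x la]; congr (_, _).
    apply/ffunP => c; rewrite /= ffunE drawn_exchange ?hC // !ffunE sV.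
    by case: (drawn u a c) => //=; rewrite /s tpermK.
  by apply/ffunP => i; rewrite !ffunE /s tpermK.
(* On the right, change variables along the exchange of the cards of [j] and [k]. *)
rewrite [RHS](reindex_onto h h) => [|u /hK //].
apply: eq_big => [u|[u a] /= /andP [/eqP eq_x la]].
  apply/idP/andP => [Pu|[Phu /eqP <-]]; last exact: hP.
  by rewrite hP // hK.
have sC := hC _ eq_x.
rewrite /= award_exchange // remaining_exchange //; congr (_ * _).
have gt := game_tuple_legal la.
rewrite (hsym (s := s) _ gt) ?sV ?tpermR //.
rewrite -(remaining_exchange la sC).
by apply/game_tuple_legal/legal_exchange.
Qed.

(** The masses of the active players are equal, and they add up to the whole
because some active player wins. *)
Lemma win_massE x j o' : j \in active x ->
  win_mass x j j o' = #|active x|%:R^-1 * award_mass x j o'.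
Proof.
move=> jx.
have C0 : #|active x|%:R != 0 :> R.
  by rewrite pnatr_eq0 -lt0n; apply/card_gt0P; exists j.
apply: (mulfI C0); rewrite mulVKf // mulr_natl -sumr_const.
rewrite (eq_bigr (fun k => win_mass x j k o')) => [|k kx]; last first.
  by rewrite win_mass_exchange.
rewrite /win_mass exchange_big /=; apply: eq_bigr => o /eqP eq_x.
rewrite exchange_big /=; apply: eq_bigr => a _.
rewrite -mulr_sumr draw_weightE; case: (boolP (legal o a)) => la; last by rewrite !mul0r.
have [_ p1 p0 _] := hp (game_tuple_legal la).
suff -> : \sum_(k in active x) p a (remaining (hands_of o) a) k = 1 by rewrite mulr1.
rewrite -p1 big_mkcond /=; apply: eq_bigr => k _; case: ifP => // /negbT.
by rewrite -eq_x -(legal_none _ la) => /eqP /p0.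
Qed.

Lemma sum_war_kernel x o' :
  \sum_(o | sizes (hands_of o) == x) war_kernel p (hands_of o) (hands_of o') =
  \sum_(j in active x) win_mass x j j o'.
Proof.
rewrite /win_mass [RHS]exchange_big /=; apply: eq_bigr => o /eqP eq_x.
rewrite [RHS]exchange_big /=; apply: eq_bigr => a _; rewrite -/(draw_weight o a).
rewrite draw_weightE; case: (boolP (legal o a)) => la; last first.
  by rewrite !mul0r big1 // => *; rewrite !mul0r.
rewrite mulr_sumr [RHS]big_mkcond /=; apply: eq_bigr => j _.
rewrite war_step_hands_of // (inj_eq (@hands_of_inj _ _)) mulrA mulrAC.
case: ifP => // /negbT; rewrite -eq_x -(legal_none _ la) => /eqP a0.
by have [_ _ -> //] := hp (game_tuple_legal la); rewrite mulr0.
Qed.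

Theorem sum_war_kernelE x o' :
  fibre_card (sizes (hands_of o')) *
    \sum_(o | sizes (hands_of o) == x) war_kernel p (hands_of o) (hands_of o') =
  fibre_card x * sticky_kernel R x (sizes (hands_of o')).
Proof.
rewrite sum_war_kernel /sticky_kernel !mulr_sumr; apply: eq_bigr => j jx.
by rewrite win_massE // mulrCA award_massE // mulrCA.
Qed.

End Rule.
End WarTurn.

(** * Uniform hands and the shuffled deck *)

Section Shuffle.
Variables (R : realType) (D : finType) (m : nat).
Implicit Types (o : {ffun D -> 'I_m}) (x y : {ffun 'I_m -> nat}).

Definition uniform_hands y (A : hands D m) : R :=
  (fibre_card R D y)^-1 * \sum_(o | sizes (hands_of o) == y) (hands_of o == A)%:R.

Lemma uniform_hands_of y o :
  uniform_hands y (hands_of o) = (fibre_card R D y)^-1 * (sizes (hands_of o) == y)%:R.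
Proof.
rewrite /uniform_hands; congr (_ * _).
rewrite big_mkcond (bigD1 o) //= eqxx big1 ?addr0 => [|u neq]; first by case: ifP.
by rewrite (inj_eq (@hands_of_inj _ _)) (negbTE neq) if_same.
Qed.

Lemma uniform_hands_eq0 y A : (forall o, hands_of o <> A) -> uniform_hands y A = 0.
Proof.
by move=> nA; rewrite /uniform_hands big1 ?mulr0 // => o _; case: eqP => [/nA|].
Qed.

Lemma sum_uniform_hands y (f : hands D m -> R) :
  \sum_A uniform_hands y A * f A =
  (fibre_card R D y)^-1 * \sum_(o | sizes (hands_of o) == y) f (hands_of o).
Proof.
under eq_bigr do rewrite -mulrA mulr_suml.
rewrite -mulr_sumr exchange_big; congr (_ * _); apply: eq_bigr => o _.
rewrite (bigD1 (hands_of o)) //= eqxx mul1r big1 ?addr0 // => A neq.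
by rewrite eq_sym (negbTE neq) mul0r.
Qed.

Lemma uniform_hands_supp y (A : hands D m) :
  uniform_hands y A != 0 -> sizes A = y /\ is_deal A.
Proof.
have [[u <-]|nA] := pselect (exists u, hands_of u = A); last first.
  by rewrite uniform_hands_eq0 ?eqxx // => u eA; apply: nA; exists u.
rewrite uniform_hands_of => nz; split; last exact: is_deal_hands_of.
by apply/eqP; apply: contraNT nz => /negbTE ->; rewrite mulr0.
Qed.

Definition prefix_sum x k : nat := (\sum_(i < m | (i < k)%N) x i)%N.

Lemma prefix_sumS x (i : 'I_m) : prefix_sum x i.+1 = (prefix_sum x i + x i)%N.
Proof.
rewrite /prefix_sum (bigD1 i) //= addnC; congr addn.
by apply: eq_bigl => k; rewrite ltnS ltn_neqAle andbC.
Qed.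

Lemma leq_prefix_sum x k l : (k <= l)%N -> (prefix_sum x k <= prefix_sum x l)%N.
Proof.
move=> kl; rewrite /prefix_sum big_mkcond [leqRHS]big_mkcond leq_sum // => i _.
by case: ifP => // ik; rewrite (leq_trans ik kl).
Qed.

Lemma prefix_sum_max x : prefix_sum x m = (\sum_i x i)%N.
Proof. by apply: eq_bigl => i; rewrite ltn_ord. Qed.

Lemma card_rank_interval k l : (l <= #|D|)%N ->
  #|finset (fun c : D => (k <= enum_rank c < l)%N)| = (l - k)%N.
Proof.
move=> lD; rewrite -sum1_card (reindex _ (onW_bij _ (enum_val_bij D))) /=.
transitivity (\sum_(i < #|D| | (k <= i < l)%N) 1)%N.
  by apply: eq_bigl => i; rewrite inE enum_valK.
rewrite -(big_mkord (fun i => (k <= i < l)%N) (fun=> 1%N)).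
rewrite -big_nat_widen // -(big_nat_widenl k 0 l xpredT) //.
by rewrite sum_nat_const_nat muln1.
Qed.

(** Shuffling amounts to renaming the cards of the deal of the unshuffled deck. *)
Lemma deal_relabel x : (\sum_i x i = #|D|)%N ->
  exists2 o : {ffun D -> 'I_m}, sizes (hands_of o) = x &
    forall g : {perm D}, deal x g = hands_of (relabel g o).
Proof.
move=> sum_x.
have dealE (g : {perm D}) i c : (c \in deal x g i) =
    (prefix_sum x i <= enum_rank (g c) < prefix_sum x i.+1)%N.
  by rewrite ffunE inE.
have deal1 : is_deal (deal x (1%g : {perm D})).
  split=> [|i j neq_ij].
    apply/finset.setP => c; rewrite finset.in_setT; apply/finset.bigcupP.
    (* Card [c] goes to the player just before the least [k] whose prefix sum
       exceeds the rank of [c]. *)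
    have ex_k : exists k, (enum_rank c < prefix_sum x k)%N.
      by exists m; rewrite prefix_sum_max sum_x ltn_ord.
    case: (ex_minnP ex_k) => -[|k] ltk mink.
      by move: ltk; rewrite /prefix_sum big1.
    have km : (k < m)%N by apply: mink; rewrite prefix_sum_max sum_x.
    exists (Ordinal km) => //; rewrite dealE perm1 /= ltk andbT leqNgt.
    by apply/negP => /mink; rewrite ltnn.
  rewrite disjoint_subset; apply/fintype.subsetP => c; rewrite inE !dealE perm1.
  move=> /andP [lei lti]; apply/negP => /andP [lej ltj].
  move: neq_ij; rewrite neq_ltn => /orP [] /(leq_prefix_sum x) le_ij.
    by move: (leq_trans lti (leq_trans le_ij lej)); rewrite ltnn.
  by move: (leq_trans ltj (leq_trans le_ij lei)); rewrite ltnn.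
have [u def_u] := is_dealP deal1; exists u.
  apply/ffunP => i; rewrite -def_u sizesE.
  transitivity (prefix_sum x i.+1 - prefix_sum x i)%N; last first.
    by rewrite prefix_sumS addKn.
  rewrite -card_rank_interval; last first.
    by rewrite -sum_x -prefix_sum_max leq_prefix_sum.
  by apply: eq_card => c; rewrite dealE perm1 inE.
move=> g; apply/ffunP => i; apply/finset.setP => c.
by rewrite in_hands_of [relabel g u c]ffunE -in_hands_of -def_u !dealE perm1.
Qed.

Lemma fibre_card_neq0 x : (\sum_i x i = #|D|)%N -> fibre_card R D x != 0.
Proof.
move=> /deal_relabel [u sz _]; rewrite pnatr_eq0 -lt0n.
by apply/card_gt0P; exists u; rewrite inE sz.
Qed.

Lemma sum_uniform_hands1 y : (\sum_i y i = #|D|)%N ->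
  \sum_A uniform_hands y A = 1.
Proof.
move=> sum_y; under eq_bigr do rewrite -[uniform_hands _ _]mulr1.
by rewrite sum_uniform_hands sum_fibre_const mulr1 mulVf ?fibre_card_neq0.
Qed.

(** The shuffle law is invariant under renaming, by translation in the group of
permutations, and it is supported by the deals with sizes [x]. *)
Lemma shuffle_law_uniform x A : (\sum_i x i = #|D|)%N ->
  shuffle_law R x A = uniform_hands x A.
Proof.
move=> sum_x; have [u0 sz dealE] := deal_relabel sum_x.
have [[u <-]|nA] := pselect (exists u, hands_of u = A); last first.
  rewrite uniform_hands_eq0 => [|u eA]; last by apply: nA; exists u.
  rewrite /shuffle_law big1 // => g _; rewrite dealE.
  by case: eqP => [eA|]; rewrite ?mulr0 //; case: nA; exists (relabel g u0).
rewrite uniform_hands_of.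
pose f u : R := \sum_(g : {perm D}) #|{perm D}|%:R^-1 * (relabel g u0 == u)%:R.
have -> : shuffle_law R x (hands_of u) = f u.
  by apply: eq_bigr => g _; rewrite dealE (inj_eq (@hands_of_inj _ _)).
have f_relabel h v : f (relabel h v) = f v.
  rewrite /f (reindex_inj (mulgI h)); apply: eq_bigr => g _.
  have -> : relabel (h * g)%g u0 = relabel h (relabel g u0).
    by apply/ffunP => c; rewrite !ffunE permM.
  by rewrite (inj_eq (bij_inj (relabel_bij m h))).
have [eq_x|neq_x] := eqVneq (sizes (hands_of u)) x; last first.
  rewrite mulr0 /f big1 // => g _; case: eqP => [eu|]; last by rewrite mulr0.
  by move: neq_x; rewrite -eu sizes_relabel sz eqxx.
apply: (mulfI (fibre_card_neq0 sum_x)); rewrite mulr1 mulfV ?fibre_card_neq0 //.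
rewrite -eq_x -sum_fibre // eq_x exchange_big /=.
transitivity (\sum_(g : {perm D}) #|{perm D}|%:R^-1 : R).
  apply: eq_bigr => g _; rewrite -mulr_sumr (bigD1 (relabel g u0)) /=; last first.
    by rewrite sizes_relabel sz.
  rewrite eqxx big1 ?addr0 ?mulr1 // => v /andP [_ neq].
  by rewrite eq_sym (negbTE neq).
rewrite sumr_const -[#|xpredT|]/#|{perm D}| -(mulr_natr (#|{perm D}|%:R^-1)) mulVf //.
by rewrite pnatr_eq0 -lt0n; apply/card_gt0P; exists 1%g.
Qed.

End Shuffle.

(** * Functions of a Markov chain with an intertwined kernel *)

Section Lumping.
Context (R : realType) (d : measure_display) (T : measurableType d).
Variable P : probability T R.
Local Open Scope classical_set_scope.

Definition pr (B : set T) : R := fine (P B).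

Lemma prE B : measurable B -> P B = (pr B)%:E.
Proof. by move=> mB; rewrite /pr fineK // fin_num_measure. Qed.

Lemma pr0 : pr set0 = 0.
Proof. by rewrite /pr measure0. Qed.

Lemma sum_pr_preimage (I : finType) (Y : T -> I) (B : set T) :
  measurable B -> (forall i, measurable (Y @^-1` [set i])) ->
  \sum_i pr (B `&` Y @^-1` [set i]) = pr B.
Proof.
move=> mB mY; apply: EFin_inj; rewrite -prE // -sumEFin.
have mBY i : measurable (B `&` Y @^-1` [set i]) by apply: measurableI.
under eq_bigr do rewrite -prE //.
have eB : B = \bigcup_(i in [set: I]) (B `&` Y @^-1` [set i]).
  apply/seteqP; split=> [w Bw|w [i _ []] //]; by exists (Y w).
rewrite [in RHS]eB measure_fin_bigcup //=; last first.
  by move=> i j _ _ [w [[_ <-] [_ <-]]].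
rewrite (fsbigE (index_enum I)) ?index_enum_uniq //=.
  by under [RHS]eq_bigl do rewrite in_setT.
by move=> i _; rewrite mem_index_enum.
Qed.

Lemma measurable_preimage_comp (S : finType) (S' : eqType) (f : S -> S') (X : T -> S) y :
  (forall s, measurable (X @^-1` [set s])) ->
  measurable ((f \o X) @^-1` [set y]).
Proof.
move=> mX.
have -> : (f \o X) @^-1` [set y] = \bigcup_(s in [set s | f s = y]) X @^-1` [set s].
  by apply/seteqP; split=> [w fw|w [s fs /= ->]] //; exists (X w).
by apply: fin_bigcup_measurable => // ; exact: finite_finset.
Qed.

(** The kernel [L] gives a conditional law of the state of [X] given its image
under [f]. *)
Section Intertwining.
Variables (S : finType) (S' : countType) (E : set S) (F : set S').
Variables (mu : S -> R) (nu : S' -> R) (K : S -> S -> R) (Q : S' -> S' -> R).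
Variables (f : S -> S') (L : S' -> S -> R) (X : nat -> T -> S).
Hypothesis chainX : markov_chain P E mu K X.
Hypothesis EF : forall s, E s -> F (f s).
Hypothesis suppL : forall y s, L y s != 0 -> f s = y /\ E s.
Hypothesis sumL : forall y, F y -> \sum_s L y s = 1.
Hypothesis mu_nu : forall s, mu s = nu (f s) * L (f s) s.
Hypothesis suppnu : forall y, ~ F y -> nu y = 0.
Hypothesis suppQ : forall y y', F y -> ~ F y' -> Q y y' = 0.
Hypothesis LK_QL : forall y s', F y -> E s' ->
  \sum_s L y s * K s s' = Q y (f s') * L (f s') s'.

Let mX t s : measurable (X t @^-1` [set s]).
Proof. by have [_ + _ _] := chainX; exact. Qed.

Definition trajectory t w : {ffun 'I_t.+1 -> S} := [ffun k : 'I_t.+1 => X k w].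

Lemma measurable_trajectory t h : measurable (@trajectory t @^-1` [set h]).
Proof.
have -> : @trajectory t @^-1` [set h] =
    \bigcap_(k in `I_t.+1) X k @^-1` [set h (inord k)].
  apply/seteqP; split=> [w <- k /= kt|w Xh]; first by rewrite ffunE inordK.
  apply/ffunP => k; rewrite ffunE; have /= -> := Xh k (ltn_ord k).
  by rewrite inord_val.
by apply: bigcap_measurable => [|k _]; [exists 0%N | exact: mX].
Qed.

(** Paths of probability zero, on which the Markov property says nothing, make
both sides vanish. *)
Lemma pr_trajectory_next t (h : {ffun 'I_t.+1 -> S}) s' :
  pr (@trajectory t @^-1` [set h] `&` X t.+1 @^-1` [set s']) =
  pr (@trajectory t @^-1` [set h]) * K (h ord_max) s'.
Proof.
have [_ _ _ /(_ t (fun k => if (k <= t)%N then h (inord k) else s'))] := chainX.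
set past := [set w | _].
have -> : past = @trajectory t @^-1` [set h].
  apply/seteqP; split=> w /= hw.
    apply/ffunP => k; have kt : (k <= t)%N by rewrite -ltnS.
    by rewrite ffunE hw // kt inord_val.
  by move=> k kt; rewrite kt -hw ffunE inordK.
rewrite leqnn ltnn /cond_prob -!/(pr _) setIC.
have -> : inord t = ord_max :> 'I_t.+1 by apply/val_inj; rewrite /= inordK.
have mYh := measurable_trajectory h.
have [P0 _|Pn0 Kh] := eqVneq (pr (@trajectory t @^-1` [set h])) 0.
  have PY0 : P (@trajectory t @^-1` [set h]) = 0%E by rewrite prE // P0.
  rewrite P0 mul0r; apply: EFin_inj; rewrite -prE; last exact: measurableI.
  apply: (@subset_measure0 _ _ _ _ _ (@trajectory t @^-1` [set h])) => //.
  exact: measurableI.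
by rewrite -Kh 1?mulrC ?divfK // prE // => -[/eqP]; rewrite (negbTE Pn0).
Qed.

Definition past (y : nat -> S') t := [set w | forall k, (k <= t)%N -> f (X k w) = y k].

Lemma measurable_past y t : measurable (past y t).
Proof.
have -> : past y t = \bigcap_(k in `I_t.+1) (f \o X k) @^-1` [set y k].
  by apply/seteqP; split.
apply: bigcap_measurable => [|k _]; first by exists 0%N.
exact: measurable_preimage_comp.
Qed.

(** Knowing the images of the earlier states instead of the states themselves
makes no difference once the present state is known: split along the paths. *)
Lemma pr_past_next y t s s' :
  pr (past y t `&` X t @^-1` [set s] `&` X t.+1 @^-1` [set s']) =
  pr (past y t `&` X t @^-1` [set s]) * K s s'.
Proof.
have mYh := @measurable_trajectory t.
have mB : measurable (past y t `&` X t @^-1` [set s]).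
  by apply: measurableI; [exact: measurable_past | exact: mX].
rewrite -(sum_pr_preimage mB mYh) mulr_suml.
rewrite -(sum_pr_preimage _ mYh); last exact: measurableI.
apply: eq_bigr => h _; rewrite setIAC.
have [[hy hs]|nh] := pselect ((forall k : 'I_t.+1, f (h k) = y k) /\ h ord_max = s).
  have -> : past y t `&` X t @^-1` [set s] `&` @trajectory t @^-1` [set h] =
      @trajectory t @^-1` [set h].
    apply: setIidr => w /= traj_h; split=> [k kt|].
      by rewrite -[k]/(val (Ordinal (kt : (k < t.+1)%N))) -hy -traj_h ffunE.
    by rewrite -hs -traj_h ffunE.
  by rewrite pr_trajectory_next hs.
have -> : past y t `&` X t @^-1` [set s] `&` @trajectory t @^-1` [set h] = set0.
  rewrite -subset0 => w [[yw sw] hw]; apply: nh; rewrite -hw; split=> [k|].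
    by rewrite ffunE yw // -ltnS.
  by rewrite ffunE.
by rewrite set0I pr0 mul0r.
Qed.

Lemma past_invalid y t : ~ F (y t) -> past y t = set0.
Proof.
move=> nF; rewrite -subset0 => w /(_ t (leqnn t)) yt; apply: nF; rewrite -yt.
by apply: EF; have [+ _ _ _] := chainX; exact.
Qed.

Lemma pr_past_sum y t c :
  (forall s, pr (past y t `&` X t @^-1` [set s]) = c * L (y t) s) ->
  F (y t) -> pr (past y t) = c.
Proof.
move=> cL Fy; rewrite -(sum_pr_preimage (measurable_past y t) (mX t)).
by under eq_bigr do rewrite cL; rewrite -mulr_sumr sumL // mulr1.
Qed.

(** Proportionality to [L (y t)] determines the constant, since [L (y t)] has
total mass one as soon as the past is possible. *)
Lemma pr_past_normalize y t c :
  (forall s, pr (past y t `&` X t @^-1` [set s]) = c * L (y t) s) ->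
  forall s, pr (past y t `&` X t @^-1` [set s]) = pr (past y t) * L (y t) s.
Proof.
move=> cL s; have [Fy|nF] := pselect (F (y t)); first by rewrite (pr_past_sum cL).
by rewrite past_invalid // set0I pr0 mul0r.
Qed.

Lemma pr_past_0 y s :
  pr (past y 0%N `&` X 0%N @^-1` [set s]) = nu (y 0%N) * L (y 0%N) s.
Proof.
have [fs|neq] := eqVneq (f s) (y 0%N).
  have -> : past y 0%N `&` X 0%N @^-1` [set s] = X 0%N @^-1` [set s].
    by apply: setIidr => w /= Xw k; rewrite leqn0 => /eqP ->; rewrite Xw.
  have [_ _ /(_ s) muX _] := chainX.
  by rewrite /pr muX /= mu_nu fs.
have -> : L (y 0%N) s = 0.
  by apply/eqP/negPn/negP => /suppL [fs _]; rewrite fs eqxx in neq.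
rewrite mulr0; have -> : past y 0%N `&` X 0%N @^-1` [set s] = set0; last exact: pr0.
rewrite -subset0 => w [/(_ 0%N (leqnn _)) yw /= Xw].
by move: neq; rewrite -yw Xw eqxx.
Qed.

(** This is where [L K = Q L] is used: one step from the law [L (y t)] gives a
multiple of [L (y t.+1)] on the states above [y t.+1]. *)
Lemma pr_past_S y t s' :
  (forall s, pr (past y t `&` X t @^-1` [set s]) = pr (past y t) * L (y t) s) ->
  pr (past y t.+1 `&` X t.+1 @^-1` [set s']) =
  pr (past y t) * Q (y t) (y t.+1) * L (y t.+1) s'.
Proof.
move=> lawt.
have [[fs Es]|nfs] := pselect (f s' = y t.+1 /\ E s'); last first.
  have -> : L (y t.+1) s' = 0 by apply/eqP/negPn/negP => /suppL /nfs.
  rewrite mulr0.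
  have -> : past y t.+1 `&` X t.+1 @^-1` [set s'] = set0; last exact: pr0.
  rewrite -subset0 => w [/(_ t.+1 (leqnn _)) yw /= Xw]; apply: nfs.
  by rewrite -yw -Xw; split=> //; have [+ _ _ _] := chainX; exact.
have -> : past y t.+1 `&` X t.+1 @^-1` [set s'] = past y t `&` X t.+1 @^-1` [set s'].
  apply/seteqP; split=> w [yw Xw]; split=> // k kt; first exact: yw (leqW kt).
  move: kt; rewrite leq_eqVlt => /predU1P [->|kt]; last exact: yw.
  by rewrite Xw.
have mB : measurable (past y t `&` X t.+1 @^-1` [set s']).
  by apply: measurableI; [exact: measurable_past | exact: mX].
rewrite -(sum_pr_preimage mB (mX t)).
under eq_bigr do rewrite setIAC pr_past_next lawt -mulrA.
rewrite -mulr_sumr -mulrA -fs.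
have [Fy|nF] := pselect (F (y t)); first by rewrite LK_QL.
by rewrite past_invalid // pr0 !mul0r.
Qed.

Lemma pr_past_law y t s :
  pr (past y t `&` X t @^-1` [set s]) = pr (past y t) * L (y t) s.
Proof.
elim: t s => [|t IHt] s.
  exact: pr_past_normalize (pr_past_0 y) s.
exact: pr_past_normalize (fun s' => pr_past_S s' IHt) s.
Qed.

(** The conditional law of the state given the past of the image depends only on
the present image, hence so does the law of the next image. *)
Lemma markov_chain_intertwining : markov_chain P F nu Q (fun t w => f (X t w)).
Proof.
have EX t w : E (X t w) by have [+ _ _ _] := chainX; exact.
have mfX t y : measurable ((fun w => f (X t w)) @^-1` [set y]).
  exact: (measurable_preimage_comp f y (mX t)).
split=> [t w|//|y|t y].
- exact: EF.
- have -> : (fun w => f (X 0%N w)) @^-1` [set y] = past (fun=> y) 0%N.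
    apply/seteqP; split=> [w /= fw k|w /(_ 0%N (leqnn _)) //].
    by rewrite leqn0 => /eqP ->.
  rewrite prE; last exact: measurable_past.
  have [Fy|nF] := pselect (F y); last by rewrite past_invalid // pr0 suppnu.
  by rewrite (pr_past_sum (pr_past_0 (fun=> y))).
rewrite -/(past y t) /= => Pn0.
have pn0 : pr (past y t) != 0.
  by apply/eqP => p0; apply: Pn0; rewrite prE ?p0 //; exact: measurable_past.
have Fy : F (y t).
  by have [//|nF] := pselect (F (y t)); rewrite past_invalid // pr0 eqxx in pn0.
rewrite /cond_prob -!/(pr _).
have -> : (fun w => f (X t.+1 w)) @^-1` [set y t.+1] `&` past y t = past y t.+1.
  apply/seteqP; split=> [w [fw yw] k|w yw].
    by rewrite leq_eqVlt => /predU1P [->|kt] //; exact: yw.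
  by split=> [|k kt]; apply: yw => //; exact: leqW.
have [Fy'|nF'] := pselect (F (y t.+1)); last first.
  by rewrite past_invalid // pr0 mul0r suppQ.
rewrite (pr_past_sum (fun s' => pr_past_S s' (pr_past_law y t)) Fy').
by rewrite mulrC mulKf.
Qed.

End Intertwining.
End Lumping.

(** * The walk of the hand sizes *)

Lemma sum_sticky_step (m : nat) (x : {ffun 'I_m -> nat}) j : j \in active x ->
  (\sum_i sticky_step x j i = \sum_i x i)%N.
Proof.
move=> jx; apply/eqP; rewrite -(eqn_add2r #|active x|).
have count_active : #|active x| = (\sum_i (i \in active x))%N.
  by rewrite -sum1_card [LHS]big_mkcond.
have count_winner : #|active x| = (\sum_i (if i == j then #|active x| else 0))%N.
  by rewrite -big_mkcond big_pred1_eq.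
(* Each active player pays one card and the winner collects all of them; adding
   the pot to both sides avoids truncated subtractions. *)
apply/eqP; rewrite [in LHS]count_active [in RHS]count_winner -!big_split.
apply: eq_bigr => i _ /=.
rewrite ffunE; case: (eqVneq i j) => [->|_].
  by rewrite jx subnK // addn_gt0; move: jx; rewrite inE => ->.
by rewrite inE lt0n; case: (x i) => //= k; rewrite subn1 addn1 addn0.
Qed.

Lemma war_sticky_intertwining (R : realType) (D : finType) (m : nat)
    (p : rule R D m) (y : {ffun 'I_m -> nat}) (A' : hands D m) :
  winning_rule p -> symmetric_rule p ->
  discrete_simplex #|D| y -> is_deal A' ->
  \sum_A uniform_hands R y A * war_kernel p A A' =
  sticky_kernel R y (sizes A') * uniform_hands R (sizes A') A'.
Proof.
move=> hp hsym sum_y /is_dealP [u ->].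
rewrite sum_uniform_hands uniform_hands_of eqxx mulr1.
apply: (mulfI (fibre_card_neq0 R sum_y)); rewrite mulVKf ?fibre_card_neq0 //.
have u0 := fibre_card_neq0 R (sum_sizes_hands_of u).
apply: (mulfI u0); rewrite (sum_war_kernelE hp hsym) [RHS]mulrCA.
by rewrite [X in _ = _ * X]mulrCA divff // mulr1.
Qed.

Theorem proposition2p2 (R : realType) (m n : nat) (hm : (2 <= m)%N)
    (hn : (0 < n)%N) (D : finType) (hD : #|D| = n) (p : rule R D m)
    (hp : winning_rule p) (hsym : symmetric_rule p)
    (x : {ffun 'I_m -> nat}) (hx : discrete_simplex n x)
    (d : measure_display) (T : measurableType d) (P : probability T R)
    (A : nat -> T -> hands D m) (hA : war P p x A) :
  simple_sticky_random_walk P n x (fun t w => [ffun i => #|A t w i|]).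
Proof.
subst n.
apply: (@markov_chain_intertwining _ _ _ P (hands D m) _ (@is_deal D m)
  (@discrete_simplex m #|D|) (shuffle_law R x) (fun y => (y == x)%:R)
  (war_kernel p) (@sticky_kernel R m) (@sizes D m) (@uniform_hands R D m) A hA).
- by move=> _ /is_dealP [u ->]; exact: sum_sizes_hands_of.
- by move=> y B; exact: uniform_hands_supp.
- by move=> y; exact: sum_uniform_hands1.
- move=> B; rewrite shuffle_law_uniform //.
  have [->|neq] := eqVneq (sizes B) x; first by rewrite mul1r.
  rewrite mul0r; apply/eqP/negPn/negP => /uniform_hands_supp [eq_x _].
  by rewrite eq_x eqxx in neq.
- by move=> y ny; case: eqP ny => // ->.
- move=> y y' sum_y ny'; rewrite /sticky_kernel big1 // => j jy.
  case: eqP => [ey|]; last by rewrite mulr0.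
  by case: ny'; rewrite -ey /discrete_simplex sum_sticky_step.
- by move=> y A' sum_y; exact: war_sticky_intertwining.
Qed.
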